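(* Let $R$ be a maximal subring of a ring $T$ and let $I$ be a nonzero proper ideal of $T$ such that $R\cap I=0$. If $M$ is a maximal ideal of $T$, then either $M=(M\cap R)\oplus I$, or $I^2=I$ is not contained in $M$ and one of the following holds: (1) $(R:T)=(R:T)_l=(R:T)_r=M=ann_T(I)$ is a minimal prime ideal of $T$. (2) $(R:T)=R\cap M$ is a maximal ideal of $R$ and $(R:T)\oplus I$ is a maximal ideal of $T$.
   Context: All rings are associative and unital (not necessarily commutative), and subrings contain the identity of the big ring; ''ideal'' means two-sided ideal. A maximal subring $R$ of $T$ is a proper subring with no subring strictly between $R$ and $T$. Conductors: $(R:T)=\{x\in T: TxT\subseteq R\}$, $(R:T)_l=\{x\in T: Tx\subseteq R\}$, $(R:T)_r=\{x\in T: xT\subseteq R\}$. $ann_T(I)=\{t\in T: tI=It=0\}$. The symbol $\oplus$ denotes an internal direct sum of additive subgroups of $T$. *)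

(* Defs.v *)
From mathcomp Require Import all_boot all_algebra.
From mathcomp Require Import boolp classical_sets.

Set Implicit Arguments.
Unset Strict Implicit.
Unset Printing Implicit Defensive.

Import GRing.Theory.
Local Open Scope classical_set_scope.
Local Open Scope ring_scope.

Section NoncommutativeRings.
Variable T : pzRingType.
Implicit Types A B I J M P Q R S X : set T.

Definition subgroup A : Prop := zmod_closed (mem A).
Definition subring S : Prop := subring_closed (mem S).

Definition maximal_subring R : Prop :=
  [/\ subring R, R <> setT
    & forall S, subring S -> R `<=` S -> S = R \/ S = setT].

(* Two-sided ideals of the subring [S]; the ideals of the ring [T] itself are
   the case [S = setT]. *)
Definition ideal S J : Prop :=
  [/\ J `<=` S, subgroup J
    & forall s x, S s -> J x -> J (s * x) /\ J (x * s)].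

Definition maximal_ideal S M : Prop :=
  [/\ ideal S M, M <> S
    & forall J, ideal S J -> M `<=` J -> J = M \/ J = S].

Definition ideal_mul A B : set T :=
  [set x | exists n (a b : 'I_n -> T),
     (forall i, A (a i) /\ B (b i)) /\ x = \sum_(i < n) a i * b i].

Definition prime_ideal P : Prop :=
  [/\ ideal setT P, P <> setT
    & forall A B, ideal setT A -> ideal setT B ->
        ideal_mul A B `<=` P -> A `<=` P \/ B `<=` P].

Definition minimal_prime_ideal P : Prop :=
  prime_ideal P /\ forall Q, prime_ideal Q -> Q `<=` P -> Q = P.

Definition conductor R : set T := [set x | forall a b, R (a * x * b)].
Definition conductor_l R : set T := [set x | forall a, R (a * x)].
Definition conductor_r R : set T := [set x | forall a, R (x * a)].

Definition ann I : set T := [set t | forall i, I i -> t * i = 0 /\ i * t = 0].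

Definition set_add A B : set T := [set a + b | a in A & b in B].

(* [X] is the internal direct sum of [A] and [B]. *)
Definition direct_sum X A B : Prop :=
  [/\ subgroup A, subgroup B, A `&` B = [set 0] & X = set_add A B].

End NoncommutativeRings.

(* Main.v *)
(* Every two-sided ideal J of T either lies in R or satisfies R + J = T.  Hence
   T = R (+) I, and an ideal of T contained in I is 0 or I; in particular I is
   a minimal ideal.  If M does not contain I, then I meets M trivially, so that
   T = M (+) I as rings with M = ann I.  The two cases of the theorem are M <= R
   and R + M = T; in the second one, R / (R /\ M) = T / M is simple, and R /\ M
   is an ideal of T because it is killed by I on both sides. *)

Require Import Defs.
From mathcomp Require Import all_boot all_algebra.
From mathcomp Require Import boolp classical_sets.

Set Implicit Arguments.
Unset Strict Implicit.
Unset Printing Implicit Defensive.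

Import GRing.Theory.
Local Open Scope classical_set_scope.
Local Open Scope ring_scope.

(** * Subgroups, subrings and ideals given as sets *)

Section Ideals.
Variable T : pzRingType.
Implicit Types A B I J M P Q R S X : set T.

(** Trades the boolean membership of [zmod_closed] for [Prop]-valued membership in a set. *)
Lemma subgroupP A :
  subgroup A <-> A 0 /\ forall x y, A x -> A y -> A (x - y).
Proof.
split=> -[A0 AB]; split; [exact/set_mem | | exact/mem_set |].
  by move=> x y /mem_set Ax /mem_set Ay; apply/set_mem/AB.
by move=> x y /set_mem Ax /set_mem Ay; apply/mem_set/AB.
Qed.

Lemma subringP S :
  subring S <-> [/\ S 1, forall x y, S x -> S y -> S (x - y)
                  & forall x y, S x -> S y -> S (x * y)].
Proof.
split=> -[S1 SB SM]; split; [exact/set_mem | | | exact/mem_set | |].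
- by move=> x y /mem_set Sx /mem_set Sy; apply/set_mem/SB.
- by move=> x y /mem_set Sx /mem_set Sy; apply/set_mem/SM.
- by move=> x y /set_mem Sx /set_mem Sy; apply/mem_set/SB.
- by move=> x y /set_mem Sx /set_mem Sy; apply/mem_set/SM.
Qed.

Lemma subring_subgroup S : subring S -> subgroup S.
Proof.
by case/subringP=> S1 SB _; apply/subgroupP; split=> //; rewrite -(subrr 1); apply: SB.
Qed.

Lemma subgroupN A x : subgroup A -> A x -> A (- x).
Proof. by case/subgroupP=> A0 AB Ax; rewrite -sub0r; apply: AB. Qed.

Lemma subgroupD A x y : subgroup A -> A x -> A y -> A (x + y).
Proof.
move=> gA Ax Ay; have [_ AB] := (subgroupP A).1 gA.
by rewrite -[y]opprK; apply: AB => //; apply: subgroupN.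
Qed.

Lemma subgroup_sum A n (f : 'I_n -> T) :
  subgroup A -> (forall i, A (f i)) -> A (\sum_(i < n) f i).
Proof.
move=> gA Af; elim/big_ind: _ => //; first by case/subgroupP: gA.
by move=> x y; apply: subgroupD.
Qed.

Lemma subgroupI A B : subgroup A -> subgroup B -> subgroup (A `&` B).
Proof.
move=> /subgroupP[A0 AB] /subgroupP[B0 BB]; apply/subgroupP; split=> // x y.
by move=> [Ax Bx] [Ay By]; split; [apply: AB | apply: BB].
Qed.

Lemma subgroup_add A B : subgroup A -> subgroup B -> subgroup (set_add A B).
Proof.
move=> /subgroupP[A0 AB] /subgroupP[B0 BB]; apply/subgroupP; split.
  by exists 0 => //; exists 0 => //; rewrite addr0.
move=> _ _ [a Aa [b Bb <-]] [c Ac [d Bd <-]].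
exists (a - c); first exact: AB.
by exists (b - d); [exact: BB | rewrite opprD addrACA].
Qed.

Lemma set_addl A B : B 0 -> A `<=` set_add A B.
Proof. by move=> B0 a Aa; exists a => //; exists 0 => //; rewrite addr0. Qed.

Lemma set_addr A B : A 0 -> B `<=` set_add A B.
Proof. by move=> A0 b Bb; exists 0 => //; exists b => //; rewrite add0r. Qed.

(** The modular law: if x = a + j, then a = x - j stays in [X] because [J] lies in [X]. With [A] the
    subring [R], it makes an ideal above [J] determined by its trace on [R]. *)
Lemma set_add_modular A X J :
  subgroup X -> J `<=` X -> set_add A J = setT -> X = set_add (X `&` A) J.
Proof.
move=> gX JX AJT; apply/seteqP; split=> [x Xx | _ [a [Xa _] [j Jj <-]]]; last first.
  by apply: subgroupD => //; apply: JX.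
have [a Aa [j Jj def_x]] : set_add A J x by rewrite AJT.
exists a; last by exists j.
split=> //; rewrite -[a](addrK j) def_x.
by case/subgroupP: gX => _; apply=> //; apply: JX.
Qed.

Lemma ideal_subgroup S J : ideal S J -> subgroup J.
Proof. by case. Qed.

Lemma ideal0 S J : ideal S J -> J 0.
Proof. by case=> _ /subgroupP[]. Qed.

Lemma idealMl J t x : ideal setT J -> J x -> J (t * x).
Proof. by case=> _ _ JM Jx; case: (JM t x). Qed.

Lemma idealMr J t x : ideal setT J -> J x -> J (x * t).
Proof. by case=> _ _ JM Jx; case: (JM t x). Qed.

Lemma ideal1 S J : ideal S J -> J 1 -> J = S.
Proof.
move=> [JS _ JM] J1; apply/seteqP; split=> // t St.
by rewrite -[t]mulr1; case: (JM t 1).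
Qed.

Lemma idealI A B : ideal setT A -> ideal setT B -> ideal setT (A `&` B).
Proof.
move=> iA iB; split=> //.
  by apply: subgroupI; [apply: ideal_subgroup iA | apply: ideal_subgroup iB].
by move=> s x _ [Ax Bx]; do 2?split; by [apply: idealMl | apply: idealMr].
Qed.

Lemma ideal_capr R J : subring R -> ideal setT J -> ideal R (R `&` J).
Proof.
move=> sR iJ; have [_ _ RM] := (subringP R).1 sR; split=> [x [] //||].
  apply: subgroupI; first exact: subring_subgroup.
  exact: ideal_subgroup iJ.
move=> s x Rs [Rx Jx]; split; split; try exact: RM.
  exact: idealMl.
exact: idealMr.
Qed.

(** Although [J] absorbs only [R], every s in [T] is r + b with r in [R] and b in [A], so
    multiplying by s agrees with multiplying by r up to elements of [A]. *)
Lemma ideal_add R J A : set_add R A = setT -> ideal R J -> ideal setT A ->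
  ideal setT (set_add J A).
Proof.
move=> RAT iJ iA; have gA := ideal_subgroup iA; split=> //.
  by apply: subgroup_add => //; apply: ideal_subgroup iJ.
move=> s _ _ [j Jj [a Aa <-]].
have [r Rr [b Ab <-]] : set_add R A s by rewrite RAT.
have [_ _ JM] := iJ; have [Jrj Jjr] := JM r j Rr Jj; split.
  exists (r * j) => //; exists ((r + b) * a + b * j); last first.
    by rewrite mulrDr (mulrDl r b j) -addrA [b * j + _]addrC.
  by apply: subgroupD => //; [apply: idealMl | apply: idealMr].
exists (j * r) => //; exists (a * (r + b) + j * b); last first.
  by rewrite mulrDl (mulrDr j) -addrA [j * b + _]addrC.
by apply: subgroupD => //; [apply: idealMr | apply: idealMl].
Qed.

Lemma idealD A B : ideal setT A -> ideal setT B -> ideal setT (set_add A B).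
Proof.
move=> iA iB; apply: (@ideal_add setT) => //.
by rewrite -subTset => t Tt; apply: set_addl => //; apply: ideal0 iB.
Qed.

Lemma ideal_ann I : ideal setT I -> ideal setT (ann I).
Proof.
move=> iI; split=> //.
  apply/subgroupP; split=> [i _ | x y ax ay i Ii]; first by rewrite mul0r mulr0.
  have [xi ix] := ax i Ii; have [yi iy] := ay i Ii.
  by rewrite mulrBl mulrBr xi ix yi iy subrr.
move=> s x _ ax; split=> i Ii.
  by rewrite -mulrA (ax i Ii).1 mulr0 mulrA (ax _ (idealMr s iI Ii)).2.
by rewrite -mulrA (ax _ (idealMl s iI Ii)).1 mulrA (ax i Ii).2 mul0r.
Qed.

Lemma ideal_mul_subl A B C : subgroup C ->
  (forall a b, A a -> B b -> C (a * b)) -> ideal_mul A B `<=` C.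
Proof.
move=> gC ABC _ [n [a [b [ABab ->]]]]; apply: subgroup_sum => // i.
by case: (ABab i) => *; apply: ABC.
Qed.

Lemma mem_ideal_mul A B a b : A a -> B b -> ideal_mul A B (a * b).
Proof.
move=> Aa Bb; exists 1%N, (fun=> a), (fun=> b); split=> //.
by rewrite big_ord1.
Qed.

Lemma ideal_ideal_mul A B :
  ideal setT A -> ideal setT B -> ideal setT (ideal_mul A B).
Proof.
move=> iA iB; split=> //.
  apply/subgroupP; split.
    exists 0%N, (fun=> 0), (fun=> 0); split; last by rewrite big_ord0.
    by split; [apply: ideal0 iA | apply: ideal0 iB].
  move=> _ _ [n [a [b [ABab ->]]]] [m [c [d [ABcd ->]]]].
  (* The two sums are concatenated: [split] tells which one an index belongs to, and the minus sign
     goes to the left factors of the second. *)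
  exists (n + m)%N.
  exists (fun i => match split i with inl j => a j | inr k => - c k end).
  exists (fun i => match split i with inl j => b j | inr k => d k end).
  split=> [i|].
    case: (split i) => j //; have [Ac Bd] := ABcd j; split=> //.
    exact: subgroupN (ideal_subgroup iA) Ac.
  rewrite big_split_ord -sumrN; congr (_ + _); apply: eq_bigr => i _.
    by rewrite (unsplitK (inl i)).
  by rewrite (unsplitK (inr i)) mulNr.
move=> s _ _ [n [a [b [ABab ->]]]]; split.
  exists n, (fun i => s * a i), b; split=> [i|].
    by have [Aa Bb] := ABab i; split=> //; apply: idealMl.
  by rewrite mulr_sumr; apply: eq_bigr => i _; rewrite mulrA.
exists n, a, (fun i => b i * s); split=> [i|].
  by have [Aa Bb] := ABab i; split=> //; apply: idealMr.
by rewrite mulr_suml; apply: eq_bigr => i _; rewrite mulrA.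
Qed.

Lemma maximal_ideal_add M J : maximal_ideal setT M -> ideal setT J ->
  ~ J `<=` M -> set_add M J = setT.
Proof.
move=> [iM _ maxM] iJ nJM.
have [] // := maxM _ (idealD iM iJ) (set_addl (ideal0 iJ)) => MJ.
by case: nJM => j Jj; rewrite -MJ; apply: set_addr => //; apply: ideal0 iM.
Qed.

(** If neither factor lies in [M], then 1 = m + a = n + b, and 1 = m(n + b) + an + ab is in [M]. *)
Lemma maximal_ideal_prime M : maximal_ideal setT M -> prime_ideal M.
Proof.
move=> mM; have [iM nMT _] := mM; have gM := ideal_subgroup iM; split=> // A B iA iB ABM.
have [AM | nAM] := pselect (A `<=` M); first by left.
have [BM | nBM] := pselect (B `<=` M); first by right.
case: nMT; apply: ideal1 => //.
have [m Mm [a Aa ma]] : set_add M A 1 by rewrite maximal_ideal_add.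
have [n Mn [b Bb nb]] : set_add M B 1 by rewrite maximal_ideal_add.
rewrite -[1]mulr1 -{1}ma -nb mulrDl.
apply: subgroupD => //; first exact: idealMr.
rewrite mulrDr; apply: subgroupD => //; first exact: idealMl.
by apply: ABM; apply: mem_ideal_mul.
Qed.

End Ideals.

(** * Ideals of [T] and of [R] for a maximal subring [R] *)

Section MaximalSubring.
Variables (T : pzRingType) (R : set T).
Hypothesis maxR : maximal_subring R.
Implicit Types I J M : set T.

Let subR : subring R. Proof. by case: maxR. Qed.

(** [R] + [J] is a subring containing [R], so maximality leaves only [R] and [T]. *)
Lemma maximal_subring_ideal J : ideal setT J ->
  J `<=` R \/ set_add R J = setT.
Proof.
move=> iJ; have gJ := ideal_subgroup iJ; have [R1 _ RM] := (subringP R).1 subR.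
have gR := subring_subgroup subR.
have sRJ : subring (set_add R J).
  apply/subringP; split; first by apply: set_addl => //; apply: ideal0 iJ.
    by case/subgroupP: (subgroup_add gR gJ).
  move=> _ _ [r Rr [a Ja <-]] [s Rs [b Jb <-]].
  exists (r * s); first exact: RM.
  exists (r * b + a * (s + b)); last by rewrite mulrDl addrA -mulrDr.
  by apply: subgroupD => //; [apply: idealMl | apply: idealMr].
have [_ _ max] := maxR.
have [] := max _ sRJ (set_addl (ideal0 iJ)) => RJ; last by right.
by left; rewrite -RJ; apply: set_addr; case/subgroupP: gR.
Qed.

(** Either [J] lies in [R], hence in the zero intersection, or [R] + [J] = [T] and the modular law
    gives [I] = ([I] meet [R]) + [J] = [J]. *)
Lemma maximal_subring_minimal_ideal I J : R `&` I = [set 0] ->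
  ideal setT J -> J `<=` I -> subgroup I -> J `<=` [set 0] \/ J = I.
Proof.
move=> RI0 iJ JI gI; case: (maximal_subring_ideal iJ) => [JR | RJT].
  by left; rewrite -RI0 => x Jx; split; [apply: JR | apply: JI].
right; rewrite (set_add_modular gI JI RJT) [I `&` R]setIC RI0.
apply/seteqP; split; first exact: set_addr.
by move=> _ [_ -> [j Jj <-]]; rewrite add0r.
Qed.

Lemma conductor_sub : conductor R `<=` R.
Proof. by move=> x /(_ 1 1); rewrite mulr1 mul1r. Qed.

Lemma ideal_sub_conductor J : ideal setT J -> J `<=` R -> J `<=` conductor R.
Proof.
by move=> iJ JR x Jx a b; apply: JR; apply: idealMr => //; apply: idealMl.
Qed.

Lemma conductor_ideal : ideal setT (conductor R).
Proof.
have gR := subring_subgroup subR; have [R0 RB] := (subgroupP R).1 gR.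
split=> //.
  apply/subgroupP; split=> [a b | x y cx cy a b]; first by rewrite mulr0 mul0r.
  by rewrite mulrBr mulrBl; apply: RB.
by move=> s x _ cx; split=> a b; rewrite mulrA; last rewrite -mulrA.
Qed.

(** An elementwise form of R / (R meet M) = T / M: an ideal [J] of [R] above the intersection yields
    the ideal [J] + [M] of [T], which is [M] or [T]. *)
Lemma maximal_ideal_capr M : maximal_ideal setT M -> set_add R M = setT ->
  maximal_ideal R (R `&` M).
Proof.
move=> [iM nMT maxM] RMT; have [R1 _ _] := (subringP R).1 subR.
split; first exact: ideal_capr.
  by move=> RM; apply: nMT; apply: ideal1 => //; rewrite -RM in R1; case: R1.
move=> J iJ RMJ; have [JR gJ _] := iJ.
have [] := maxM _ (ideal_add RMT iJ iM) (set_addr (ideal0 iJ)) => JM.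
  left; apply/seteqP; split=> // j Jj; split; first exact: JR.
  by rewrite -JM; apply: set_addl => //; apply: ideal0 iM.
right; rewrite setIC in RMJ.
have gR := subring_subgroup subR; apply/seteqP; split=> // r Rr.
have [j Jj [m Mm jm]] : set_add J M r by rewrite JM.
rewrite -jm; apply: subgroupD => //; apply: RMJ; split=> //.
have -> : m = r - j by rewrite -jm addrC addKr.
by case/subgroupP: gR => _; apply=> //; apply: JR.
Qed.

(** Here T / (J + I) is R / J: an ideal [K] above [J] + [I] equals ([K] meet [R]) + [I], and [K]
    meet [R] is [J] or [R]. *)
Lemma maximal_ideal_add_complement I J : ideal setT I -> R `&` I = [set 0] ->
  set_add R I = setT -> maximal_ideal R J -> maximal_ideal setT (set_add J I).
Proof.
move=> iI RI0 RIT [iJ nJR maxJ]; have [JR gJ _] := iJ.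
have [R1 RB _] := (subringP R).1 subR.
have iJI : ideal setT (set_add J I) by apply: ideal_add iJ iI.
have I0 := ideal0 iI; split=> // [JIT | K iK JIK].
  apply: nJR; apply: ideal1 => //.
  have [j Jj [i Ii ji]] : set_add J I 1 by rewrite JIT.
  have : (R `&` I) i.
    split=> //; have -> : i = 1 - j by rewrite -ji addrC addKr.
    by apply: RB => //; apply: JR.
  by rewrite RI0 => i0; rewrite -ji i0 addr0.
have IK : I `<=` K by move=> i Ii; apply: JIK; apply: set_addr => //; apply: ideal0 iJ.
have [||RKJ|RKR] := maxJ (R `&` K); first exact: ideal_capr.
- by move=> j Jj; split; [exact: JR | apply: JIK; apply: set_addl].
- left; rewrite (set_add_modular (ideal_subgroup iK) IK RIT).
  by rewrite [K `&` R]setIC RKJ.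
- by right; apply: ideal1 => //; rewrite -RKR in R1; case: R1.
Qed.

End MaximalSubring.

(** * The dichotomy for a maximal ideal [M] *)

Theorem proposition2p7 (T : pzRingType) (R I M : set T)
  (hR : maximal_subring R)
  (hI : ideal setT I) (hI0 : I <> [set 0]) (hIT : I <> setT)
  (hRI : R `&` I = [set 0])
  (hM : maximal_ideal setT M) :
  direct_sum M (M `&` R) I \/
  [/\ ideal_mul I I = I, ~ I `<=` M
    & [/\ conductor R = conductor_l R, conductor_l R = conductor_r R,
          conductor_r R = M, M = ann I & minimal_prime_ideal M]
      \/
      [/\ conductor R = R `&` M, maximal_ideal R (conductor R)
        & exists2 N : set T,
            direct_sum N (conductor R) I & maximal_ideal setT N]].
Proof.
have [sR _ _] := hR; have [R1 RB RM] := (subringP R).1 sR.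
have gR := subring_subgroup sR; have [R0 _] := (subgroupP R).1 gR.
have gI := ideal_subgroup hI; have I0 := ideal0 hI.
have [iM nMT maxM] := hM; have gM := ideal_subgroup iM; have M0 := ideal0 iM.
have RI x : R x -> I x -> x = 0.
  by move=> Rx Ix; have : (R `&` I) x by []; rewrite hRI.
have nI0 : ~ I `<=` [set 0].
  by move=> sI; apply: hI0; apply/seteqP; split=> // _ ->.
have RIT : set_add R I = setT.
  case: (maximal_subring_ideal hR hI) => // IR.
  by case: nI0 => x Ix; apply: RI => //; apply: IR.
have [IM | nIM] := pselect (I `<=` M).
  left; split=> //; first exact: subgroupI; last exact: set_add_modular.
  by rewrite -setIA hRI; apply/seteqP; split=> [x [] | _ ->].
right.
have minI := maximal_subring_minimal_ideal hR hRI.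
have prM : prime_ideal M := maximal_ideal_prime hM.
(* By minimality the square of [I] is 0 or [I]; were it 0, the prime ideal [M] would contain [I]. *)
have II : ideal_mul I I = I.
  have iII : ideal setT (ideal_mul I I) by apply: ideal_ideal_mul.
  have [||II0|//] := minI _ iII => //.
    by apply: ideal_mul_subl => // a b _; apply: idealMl.
  by case: prM => _ _ /(_ I I hI hI) [] // x /II0 ->.
have MI0 x : M x -> I x -> x = 0.
  have [|//|MI0|MII] := minI _ (idealI iM hI); first by move=> ? [].
    by move=> Mx Ix; apply: MI0.
  by case: nIM => y; rewrite -MII => -[].
have MIT : set_add M I = setT by apply: maximal_ideal_add.
(* Products of [M] with [I] lie in both, so they vanish and [M] lies in [ann I]. The latter is not
   [T], since 1 does not kill [I]. *)
have annM : M = ann I.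
  have [] // := maxM _ (ideal_ann hI).
    by move=> m Mm i Ii; split; apply: MI0; by [apply: idealMl | apply: idealMr].
  move=> annT; case: nI0 => i Ii.
  have : ann I 1 by rewrite annT.
  by move=> /(_ i Ii)[]; rewrite mul1r.
(* The component e of 1 in [I] serves for the one-sided conductors. *)
have [m Mm [e Ie me]] : set_add M I 1 by rewrite MIT.
split=> //; have [MR | RMT] := maximal_subring_ideal hR iM; [left | right].
  have MC := ideal_sub_conductor iM MR.
  have CM : conductor R = M.
    have [//|CT] := maxM _ (conductor_ideal hR) MC.
    case: nI0 => i Ii; apply: RI => //; apply: (@conductor_sub T R).
    by rewrite CT.
  (* For x in the left conductor, ex lies in [R] and in [I], so it is 0 and x = mx is in [M]. The
     right side is symmetric. *)
  have ClM : conductor_l R = M.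
    apply/seteqP; split=> [x cx | x Mx a]; last by apply: MR; apply: idealMl.
    rewrite -[x]mul1r -me mulrDl (RI (e * x)) ?addr0; last exact: idealMr.
      exact: idealMr.
    exact: cx.
  have CrM : conductor_r R = M.
    apply/seteqP; split=> [x cx | x Mx a]; last by apply: MR; apply: idealMr.
    rewrite -[x]mulr1 -me mulrDr (RI (x * e)) ?addr0; last exact: idealMl.
      exact: idealMl.
    exact: cx.
  (* Minimality: [M] times [I] is 0, so a prime [Q] inside [M] contains [M] or [I], and [I] is not
     inside [M]. *)
  split; rewrite ?CM ?ClM ?CrM //; split=> // Q [iQ _ prQ] QM.
  have Q0 := ideal0 iQ.
  have [|MQ|IQ] := prQ M I iM hI.
  - apply: ideal_mul_subl => [|a b Ma Ib]; first exact: ideal_subgroup iQ.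
    by rewrite annM in Ma; rewrite (Ma b Ib).1.
  - by apply/seteqP; split.
  - by case: nIM => x /IQ /QM.
have CRM : conductor R = R `&` M.
  apply/seteqP; split=> [x cx | x [Rx Mx] a b].
    split; first exact: conductor_sub cx.
    have iC := conductor_ideal hR.
    (* The conductor is an ideal inside [R], so its products with [I] fall in the zero intersection
       of [R] and [I]. *)
    rewrite annM => i Ii; split; apply: RI; do ?[exact: idealMl | exact: idealMr].
      exact: conductor_sub (idealMr _ iC cx).
    exact: conductor_sub (idealMl _ iC cx).
  (* As x kills [I], only the [R]-components of a and b survive: axb = rxs, which is in [R]. *)
  have [r Rr [i Ii <-]] : set_add R I a by rewrite RIT.
  have [s Rs [j Ij <-]] : set_add R I b by rewrite RIT.
  have ax : ann I x by rewrite -annM.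
  rewrite mulrDl (ax i Ii).2 addr0 mulrDr -[r * x * j]mulrA (ax j Ij).1 mulr0.
  by rewrite addr0; apply: (RM) => //; apply: RM.
have mC : maximal_ideal R (conductor R) by rewrite CRM; exact: maximal_ideal_capr hM RMT.
split=> //; exists (set_add (conductor R) I); last exact: (maximal_ideal_add_complement hR).
have gC := ideal_subgroup (conductor_ideal hR).
split=> //; apply/seteqP; split=> [x [cx Ix] | _ ->].
  by apply: RI => //; apply: conductor_sub cx.
by split=> //; case/subgroupP: gC.
Qed.
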